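(* Let $a\in\mathbb{C}$ with $|a|<1$ and let $1\le p<\infty$. For every $f\in L^p(\mathbb{T})$ and every $n=0,1,2,\dots$, $$\|\sigma_n^a(f)\|_p\le\left(\frac{1+|a|}{1-|a|}\right)^{2/p}\|f\|_p .$$
   Context: $\mathbb{T}=\mathbb{R}/2\pi\mathbb{Z}$; functions on $\mathbb{T}$ are real- or complex-valued and identified with $2\pi$-periodic functions on $\mathbb{R}$; $\|f\|_p=\left(\frac1{2\pi}\int_{\mathbb{T}}|f(x)|^p\,dx\right)^{1/p}$. For $a=|a|e^{it_a}$, $|a|<1$, the nonlinear phase function $\theta_a:\mathbb{R}\to\mathbb{R}$ is the continuous function with $e^{i\theta_a(t)}=\dfrac{e^{it}-a}{1-\overline{a}e^{it}}$ (a fixed choice of continuous branch). It is strictly increasing, satisfies $\theta_a(t+2\pi)=\theta_a(t)+2\pi$, and has derivative the Poisson kernel $\theta_a'(t)=p_a(t)=\dfrac{1-|a|^2}{1-2|a|\cos(t-t_a)+|a|^2}$. For $f\in L^1(\mathbb{T})$, $c_k(f)=\dfrac1{2\pi}\displaystyle\int_{-\pi}^{\pi}f(t)e^{-ik\theta_a(t)}p_a(t)\,dt$ for $k\in\mathbb{Z}$, $S_n^a(f)(x)=\displaystyle\sum_{k=-n}^{n}c_k(f)e^{ik\theta_a(x)}$, and the $n$-th Fejér (Cesàro) mean is $\sigma_n^a(f)(x)=\dfrac1{n+1}\displaystyle\sum_{k=0}^{n}S_k^a(f)(x)$. *)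

(* Defs.v *)
From mathcomp Require Import all_boot all_order all_algebra.
From mathcomp Require Import complex.
From mathcomp Require Import all_classical all_reals all_analysis.
From mathcomp Require Import ring lra.

Set Implicit Arguments.
Unset Strict Implicit.
Unset Printing Implicit Defensive.

Import Order.TTheory GRing.Theory Num.Theory.
Import numFieldNormedType.Exports.

Local Open Scope classical_set_scope.
Local Open Scope ring_scope.
Local Open Scope complex_scope.

(* The real-valued modulus; the generic norm on [R[i]] is [R[i]]-valued. *)
Notation cabs := ComplexField.Normc.normc.

Definition expi {R : realType} (x : R) : R[i] := cos x +i* sin x.

(* [R[i]] carries no integration theory: integrate real and imaginary parts.
   As for [Rintegral], this is only meaningful for integrable integrands. *)
Definition Cintegral {R : realType} (D : set R) (g : R -> R[i]) : R[i] :=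
  (\int[@lebesgue_measure R]_(t in D) complex.Re (g t)) +i*
  (\int[@lebesgue_measure R]_(t in D) complex.Im (g t)).

Definition period {R : realType} : set R := `[- pi, pi]%classic.

(* Functions on the circle are 2 pi-periodic functions on R.  The norm is
   extended-real-valued: it is +oo for a measurable function outside L^p. *)
Definition normLp {R : realType} (p : R) (f : R -> R[i]) : \bar R :=
  (((2 * pi)^-1%R%:E *
      \int[@lebesgue_measure R]_(t in period) (cabs (f t) `^ p)%:E)
   `^ p^-1)%E.

(* Elements of L^p(T) are represented by Borel measurable functions; every
   a.e. class of Lebesgue measurable functions contains one. *)
Definition mem_Lp {R : realType} (p : R) (f : R -> R[i]) : Prop :=
  [/\ periodic f (2 * pi),
      measurable_fun [set: R] (fun t => complex.Re (f t)),
      measurable_fun [set: R] (fun t => complex.Im (f t)) &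
      (normLp p f < +oo)%E].

(* [theta] is a continuous branch of the nonlinear phase function of [a];
   two branches differ by a constant in 2 pi Z. *)
Definition nonlinear_phase {R : realType} (a : R[i]) (theta : R -> R) : Prop :=
  continuous theta /\
  forall t, expi (theta t) = (expi t - a) / (1 - a^* * expi t).

Section FejerMeans.
(* [ta] is an argument of [a] and [theta] a branch of its phase function. *)
Context {R : realType} (a : R[i]) (ta : R) (theta : R -> R).

Definition poisson_kernel (t : R) : R :=
  (1 - cabs a ^+ 2) / (1 - 2 * cabs a * cos (t - ta) + cabs a ^+ 2).

Definition coef (f : R -> R[i]) (k : int) : R[i] :=
  ((2 * pi)^-1)%:C *
  Cintegral period
    (fun t => f t * expi (- (k%:~R * theta t)) * (poisson_kernel t)%:C).

(* The index j = 0, ..., 2n stands for k = j - n = -n, ..., n. *)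
Definition partial_sum (f : R -> R[i]) (n : nat) (x : R) : R[i] :=
  \sum_(j < n.*2.+1)
    coef f (j%:Z - n%:Z) * expi ((j%:Z - n%:Z)%:~R * theta x).

Definition fejer_mean (f : R -> R[i]) (n : nat) (x : R) : R[i] :=
  (n.+1%:R)^-1 * \sum_(k < n.+1) partial_sum f k x.

End FejerMeans.

Lemma arg_exists (R : realType) (a : R[i]) :
  exists ta : R, a = (cabs a)%:C * expi ta.
Proof.
case: a => x y; set r := cabs _.
have rE : r ^+ 2 = x ^+ 2 + y ^+ 2.
  by rewrite /r /= sqr_sqrtr// addr_ge0 ?sqr_ge0.
have r0 : 0 <= r by exact: sqrtr_ge0.
have [r_eq0|rn0] := eqVneq r 0.
  exists 0; apply/eqP; rewrite r_eq0 mul0r eq_complex /=.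
  move: rE; rewrite r_eq0 expr0n /= => /esym/eqP.
  by rewrite paddr_eq0 ?sqr_ge0// !sqrf_eq0.
have rgt0 : 0 < r by rewrite lt_def rn0.
have hx : -1 <= x / r <= 1.
  rewrite ler_pdivlMr// ler_pdivrMr// mulN1r mul1r.
  by have := sqr_ge0 y => y0; apply/andP; split; nra.
have hs : sin (acos (x / r)) = `|y| / r.
  rewrite sin_acos//.
  have -> : 1 - (x / r) ^+ 2 = (`|y| / r) ^+ 2.
    rewrite !expr_div_n real_normK ?num_real// rE.
    by field; rewrite -rE sqrf_eq0.
  by rewrite sqrtr_sqr ger0_norm// divr_ge0.
have hc := acosK hx.
exists (if 0 <= y then acos (x / r) else - acos (x / r)).
apply/eqP; rewrite eq_complex /=; case: ifPn => y0 /=;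
  rewrite ?cosN ?sinN hc hs !mul0r subr0 addr0 ?mulrN !(mulrC r) !divfK// eqxx/=.
  by rewrite ger0_norm.
by rewrite ltr0_norm ?opprK// ltNge.
Qed.

Lemma nonlinear_phase_exists (R : realType) (a : R[i]) :
  cabs a < 1 -> exists theta, nonlinear_phase a theta.
Proof.
case: a => x y a1.
have r1 : x ^+ 2 + y ^+ 2 < 1.
  rewrite -[X in X < _]sqr_sqrtr ?addr_ge0 ?sqr_ge0//.
  by rewrite expr_lt1// sqrtr_ge0.
pose u (t : R) : R := 1 - (x * cos t + y * sin t).
pose v (t : R) : R := x * sin t - y * cos t.
have u0 t : 0 < u t.
  have := cos2Dsin2 t; rewrite /u; set c := cos t; set s := sin t => cs.
  have h : (x * c + y * s) ^+ 2 <= x ^+ 2 + y ^+ 2.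
    have := sqr_ge0 (x * s - y * c); nra.
  nra.
exists (fun t => t + 2 * atan (v t / u t)); split.
  move=> t.
  have cu : {for t, continuous u}.
    apply: cvgB; first exact: cvg_cst.
    apply: cvgD; apply: cvgM; try exact: cvg_cst.
      exact: continuous_cos.
    exact: continuous_sin.
  have cv : {for t, continuous v}.
    apply: cvgB; apply: cvgM; try exact: cvg_cst.
      exact: continuous_sin.
    exact: continuous_cos.
  apply: cvgD; first exact: cvg_id.
  apply: cvgM; first exact: cvg_cst.
  apply: (@continuous_comp _ _ _ (fun t => v t / u t) (@atan R)).
    by apply: cvgM; [exact: cv|apply: cvgV; [rewrite gt_eqF//|exact: cu]].
  exact: continuous_atan.
move=> t; set q := v t / u t.
pose D := u t ^+ 2 + v t ^+ 2.
have D0 : D != 0 by rewrite gt_eqF// /D ltr_wpDr ?sqr_ge0// exprn_gt0.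
have un0 : u t != 0 by rewrite gt_eqF.
have q1 : 1 + q ^+ 2 = D / u t ^+ 2 by rewrite /q /D; field.
have hcos : cos (2 * atan q) = (u t ^+ 2 - v t ^+ 2) / D.
  have -> : 2 * atan q = atan q *+ 2 by rewrite mulr_natl.
  rewrite cos_mulr2n cos_atan exprVn sqr_sqrtr ?addr_ge0 ?sqr_ge0// q1.
  by rewrite /D in D0 *; field; rewrite D0 un0.
have hsin : sin (2 * atan q) = 2 * u t * v t / D.
  have -> : 2 * atan q = atan q *+ 2 by rewrite mulr_natl.
  have ca : cos (atan q) != 0.
    by rewrite cos_atan invr_eq0 sqrtr_eq0 -ltNge ltr_wpDr ?sqr_ge0.
  have -> : sin (atan q *+ 2) = 2 * cos (atan q) ^+ 2 * tan (atan q).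
    by rewrite sin_mulr2n /tan -mulr_natl; field.
  rewrite atanK cos_atan exprVn sqr_sqrtr ?addr_ge0 ?sqr_ge0// q1 /q.
  by rewrite /D in D0 *; field; rewrite D0 un0.
have den : 1 - (x +i* y)^* * expi t = u t -i* v t.
  by apply/eqP; rewrite eq_complex /= /u /v; apply/andP; split; apply/eqP; ring.
have den0 : u t -i* v t != 0 by rewrite eq_complex /= negb_and un0.
rewrite den; apply: (mulIf den0); rewrite divfK//.
have cs := cos2Dsin2 t.
have K1 : cos (2 * atan q) * u t + sin (2 * atan q) * v t = u t.
  by rewrite hcos hsin /D in D0 *; field.
have K2 : sin (2 * atan q) * u t - cos (2 * atan q) * v t = v t.
  by rewrite hcos hsin /D in D0 *; field.
rewrite /expi cosD sinD; move: K1 K2.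
set C := cos (2 * _); set S := sin (2 * _) => K1 K2.
apply/eqP; rewrite eq_complex /=; apply/andP; split; apply/eqP.
  transitivity (cos t * (C * u t + S * v t) - sin t * (S * u t - C * v t)).
    ring.
  rewrite K1 K2 /u /v; transitivity (cos t - x * (cos t ^+ 2 + sin t ^+ 2)).
    ring.
  by rewrite cs; ring.
transitivity (sin t * (C * u t + S * v t) + cos t * (S * u t - C * v t)).
  ring.
rewrite K1 K2 /u /v; transitivity (sin t - y * (cos t ^+ 2 + sin t ^+ 2)).
  ring.
by rewrite cs; ring.
Qed.

(* Main.v *)
Require Import Defs.
From mathcomp Require Import all_boot all_order all_algebra.
From mathcomp Require Import complex.
From mathcomp Require Import all_classical all_reals all_analysis.
From mathcomp Require Import measurable_realfun.
From mathcomp Require Import ring lra.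

Set Implicit Arguments.
Unset Strict Implicit.
Unset Printing Implicit Defensive.

Import Order.TTheory GRing.Theory Num.Theory.
Import numFieldNormedType.Exports.
Import boolp.

Local Open Scope classical_set_scope.
Local Open Scope ring_scope.
Local Open Scope complex_scope.

(** The mean [fejer_mean a ta theta f n] is an average of [f]: exchanging the
    finite sums with the integral defining the coefficients gives
    [(2 pi)^-1 \int f t * (P t * K (theta x - theta t)) dt], where [P] is the
    Poisson kernel of [a] and [K] the classical Fejer kernel
    ([fejer_mean_kernel]).  Since [K] is a squared modulus and [P] is positive,
    the weight is nonnegative.

    The phase [theta] has derivative [P] and increases by [2 pi] over a period,
    so the functions [expi (k * theta)], [k] in [int], are orthonormal for the
    measure [P t dt / (2 pi)] ([Cintegral_expi_poisson]).  This has two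
    consequences.  The weight has total mass one for every [x]
    ([fejer_average1]), whence, by Jensen's inequality, [|sigma f| `^ p] is at
    most the mean of [|f| `^ p] ([fejer_average_jensen]).  And the mean
    preserves the integral against [P] ([Rintegral_fejer_average]), only the
    coefficient of frequency zero surviving the integration; no exchange of
    two integrals is needed, since a mean is a trigonometric polynomial in
    [theta].

    Thus [\int |sigma f| `^ p * P <= \int |f| `^ p * P].  With
    [C := (1 + |a|) / (1 - |a|)], the bounds [C^-1 <= P <= C] replace [P] by
    [1] on both sides at the price of the factor [C ^+ 2], and taking [p]-th
    roots turns it into [C `^ (2 / p)]. *)

(** * Complex numbers and the unit circle *)

Lemma ReM (R : realType) (z w : R[i]) : complex.Re (z * w) =
  complex.Re z * complex.Re w + complex.Im z * - complex.Im w.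
Proof. by case: z w => x y [u v] /=; rewrite mulrN. Qed.

Lemma ImM (R : realType) (z w : R[i]) : complex.Im (z * w) =
  complex.Re z * complex.Im w + complex.Im z * complex.Re w.
Proof. by case: z w => x y [u v]. Qed.

Lemma mul_complex_real (R : realType) (z : R[i]) (r : R) :
  z * r%:C = (complex.Re z * r) +i* (complex.Im z * r).
Proof.
case: z => x y.
by apply/eqP; rewrite eq_complex /=; apply/andP; split; apply/eqP; ring.
Qed.

Lemma normc_ge0 (R : realType) (z : R[i]) : 0 <= cabs z.
Proof. by case: z => x y; exact: sqrtr_ge0. Qed.

Lemma normcE (R : realType) (z : R[i]) :
  cabs z = Num.sqrt (complex.Re z ^+ 2 + complex.Im z ^+ 2).
Proof. by case: z. Qed.

Lemma normr_Re_le (R : realType) (z : R[i]) : `|complex.Re z| <= cabs z.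
Proof.
by rewrite normcE -sqrtr_sqr ler_sqrt ?addr_ge0 ?sqr_ge0// lerDl sqr_ge0.
Qed.

Lemma normr_Im_le (R : realType) (z : R[i]) : `|complex.Im z| <= cabs z.
Proof.
by rewrite normcE -sqrtr_sqr ler_sqrt ?addr_ge0 ?sqr_ge0// lerDr sqr_ge0.
Qed.

Lemma expi0 (R : realType) : expi (0 : R) = 1.
Proof. by rewrite /expi cos0 sin0. Qed.

Lemma expiD (R : realType) (x y : R) : expi (x + y) = expi x * expi y.
Proof.
by apply/eqP; rewrite eq_complex /= cosD sinD [X in _ && (X == _)]addrC !eqxx.
Qed.

Lemma expi_neq0 (R : realType) (x : R) : expi x != 0.
Proof.
apply/eqP => e; have := expiD x (- x).
by rewrite e mul0r subrr expi0 => /eqP; rewrite oner_eq0.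
Qed.

Lemma expiN (R : realType) (x : R) : expi (- x) = (expi x)^-1.
Proof.
by apply: (mulfI (expi_neq0 x)); rewrite -expiD subrr expi0 mulfV ?expi_neq0.
Qed.

Lemma conj_polar (R : realType) (r x : R) :
  ((r%:C * expi x)^* )%R = r%:C * expi (- x).
Proof.
by rewrite /expi cosN sinN; apply/eqP; rewrite eq_complex /=;
  apply/andP; split; apply/eqP; ring.
Qed.

Lemma expiMn (R : realType) (n : nat) (x : R) : expi (n%:R * x) = expi x ^+ n.
Proof.
elim: n => [|n IH]; first by rewrite mul0r expi0 expr0.
by rewrite -natr1 mulrDl mul1r expiD IH exprSr.
Qed.

Lemma expiMz (R : realType) (k : int) (x : R) : expi (k%:~R * x) = expi x ^ k.
Proof.
case: k => n; first exact: expiMn.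
by rewrite NegzE mulrNz mulNr expiN expiMn.
Qed.

Lemma expi2pi (R : realType) : expi (2 * pi : R) = 1.
Proof. by rewrite mulr_natl /expi cos2pi sin2pi. Qed.

Lemma continuous_expi_comp (R : realType) (h : R -> R) : continuous h ->
  continuous (fun t => complex.Re (expi (h t))) /\
  continuous (fun t => complex.Im (expi (h t))).
Proof.
move=> ch; split => t /=.
  by apply: (continuous_comp (ch t)); exact: continuous_cos.
by apply: (continuous_comp (ch t)); exact: continuous_sin.
Qed.

(** With [x := atan (v / u)], the product [expi x * (u -i* v)] is real, since
    [v * cos x = u * sin x]; hence it is its own conjugate
    [expi (- x) * (u +i* v)]. *)
Lemma expi_2atan (R : realType) (u v : R) : u != 0 ->
  expi (2 * atan (v / u)) * (u -i* v) = u +i* v.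
Proof.
move=> u0; set x := atan (v / u).
have cx0 : cos x != 0.
  by rewrite gt_eqF// cos_gt0_pihalf// atan_gtNpi2 atan_ltpi2.
have vc : v * cos x = u * sin x.
  have -> : sin x = tan x * cos x by rewrite /tan divfK.
  by rewrite /x atanK mulrA [u * _]mulrC divfK.
have -> : 2 * x = x + x by ring.
have cs := cos2Dsin2 x.
rewrite expiD; apply/eqP; rewrite eq_complex /=; apply/andP; split; apply/eqP.
  transitivity (u * (cos x ^+ 2 - sin x ^+ 2) + 2 * sin x * (v * cos x)).
    by ring.
  by rewrite vc; transitivity (u * (cos x ^+ 2 + sin x ^+ 2));
    [ring|rewrite cs mulr1].
transitivity (- cos x * (v * cos x) + v * sin x ^+ 2 + 2 * cos x * (u * sin x)).
  by ring.
by rewrite -vc; transitivity (v * (cos x ^+ 2 + sin x ^+ 2));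
  [ring|rewrite cs mulr1].
Qed.

(** * The phase and the Poisson kernel *)

(** An explicit branch of the phase, convenient to differentiate. *)
Definition phase_branch (R : realType) (a : R[i]) (ta t : R) : R :=
  t + 2 * atan (cabs a * sin (t - ta) / (1 - cabs a * cos (t - ta))).

Lemma mobius_cos_gt0 (R : realType) (a : R[i]) (s : R) :
  cabs a < 1 -> 0 < 1 - cabs a * cos s.
Proof.
move=> a1; have := normc_ge0 a; have := cos_le1 s; have := cos_geN1 s.
nra.
Qed.

(** With [w := 1 - a^* * expi t] one has [expi t - a = expi t * w^*], and
    [w^* / w] is the exponential of twice the argument of [w^*]. *)
Lemma expi_phase_branch (R : realType) (a : R[i]) (ta t : R) :
  cabs a < 1 -> a = (cabs a)%:C * expi ta ->
  expi (phase_branch a ta t) = (expi t - a) / (1 - a^* * expi t).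
Proof.
move=> a1 aE; rewrite /phase_branch expiD.
have u0 := mobius_cos_gt0 (t - ta) a1.
set u := 1 - _ in u0 *; set v := cabs a * sin _.
have wE : 1 - a^* * expi t = u -i* v.
  rewrite aE conj_polar -mulrA -expiD addrC [- ta + t]addrC.
  by rewrite /u /v; apply/eqP; rewrite eq_complex /=;
    apply/andP; split; apply/eqP; ring.
have w0 : u -i* v != 0 by rewrite eq_complex /= negb_and gt_eqF.
rewrite wE; apply: (mulIf w0); rewrite divfK// -mulrA expi_2atan ?gt_eqF//.
have -> : u +i* v = 1 - (cabs a)%:C * expi (ta - t).
  rewrite -[ta - t]opprB /expi cosN sinN /u /v.
  by apply/eqP; rewrite eq_complex /=; apply/andP; split; apply/eqP; ring.
by rewrite mulrBr mulr1 mulrCA -expiD addrCA subrr addr0 -aE.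
Qed.

Lemma poisson_denE (R : realType) (a : R[i]) (s : R) :
  1 - 2 * cabs a * cos s + cabs a ^+ 2 =
  (1 - cabs a * cos s) ^+ 2 + (cabs a * sin s) ^+ 2.
Proof.
transitivity (1 - 2 * cabs a * cos s + cabs a ^+ 2 * (cos s ^+ 2 + sin s ^+ 2)).
  by rewrite cos2Dsin2 mulr1.
by ring.
Qed.

Lemma poisson_den_gt0 (R : realType) (a : R[i]) (s : R) : cabs a < 1 ->
  0 < 1 - 2 * cabs a * cos s + cabs a ^+ 2.
Proof.
move=> a1; rewrite poisson_denE ltr_pwDl ?sqr_ge0// exprn_gt0//.
exact: mobius_cos_gt0.
Qed.

Lemma is_derive_phase_branch (R : realType) (a : R[i]) (ta t : R) :
  cabs a < 1 ->
  is_derive t 1 (phase_branch a ta) (poisson_kernel a ta t).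
Proof.
move=> a1; have u0 := mobius_cos_gt0 (t - ta) a1.
have D0 := poisson_den_gt0 (t - ta) a1.
have cs := cos2Dsin2 (t - ta).
have u_neq0 : 1 - cabs a * cos (t - ta) != 0 by rewrite gt_eqF.
rewrite /phase_branch; apply: is_derive_eq.
rewrite /poisson_kernel /GRing.scale /=.
move: u0 D0 cs; rewrite poisson_denE.
set r := cabs a; set c := cos _; set s := sin _ => u0 D0 cs.
(* Homogenizing the numerator leaves an identity of rational functions in
   the independent variables [r], [c] and [s]. *)
have -> : 1 - r ^+ 2 = 1 - r ^+ 2 * (c ^+ 2 + s ^+ 2) by rewrite cs mulr1.
by field; rewrite !gt_eqF.
Qed.

Lemma poisson_ge0 (R : realType) (a : R[i]) (ta t : R) :
  cabs a < 1 -> 0 <= poisson_kernel a ta t.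
Proof.
move=> a1; apply: divr_ge0; last exact/ltW/poisson_den_gt0.
by have := normc_ge0 a; nra.
Qed.

(** This bound and [poisson_ge] come from [(1 - r) ^+ 2 <= D <= (1 + r) ^+ 2], where
    [r := cabs a] and [D := 1 - 2 * r * cos s + r ^+ 2]. *)
Lemma poisson_le (R : realType) (a : R[i]) (ta t : R) :
  cabs a < 1 -> poisson_kernel a ta t <= (1 + cabs a) / (1 - cabs a).
Proof.
move=> a1; have r0 := normc_ge0 a; have D0 := poisson_den_gt0 (t - ta) a1.
have c1 := cos_le1 (t - ta); have b0 : 0 < 1 - cabs a by rewrite subr_gt0.
rewrite /poisson_kernel ler_pdivrMr// mulrAC ler_pdivlMr//.
move: (cabs a) (cos _) => r c in a1 r0 D0 c1 b0 *.
have : 0 <= (1 + r) * (r * (1 - c)) by rewrite !mulr_ge0//; lra.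
nra.
Qed.

Lemma poisson_ge (R : realType) (a : R[i]) (ta t : R) :
  cabs a < 1 -> 1 <= (1 + cabs a) / (1 - cabs a) * poisson_kernel a ta t.
Proof.
move=> a1; have r0 := normc_ge0 a; have D0 := poisson_den_gt0 (t - ta) a1.
have c1 := cos_geN1 (t - ta); have b0 : 0 < 1 - cabs a by rewrite subr_gt0.
rewrite /poisson_kernel mulrA ler_pdivlMr// mul1r [leRHS]mulrAC ler_pdivlMr//.
move: (cabs a) (cos _) => r c in a1 r0 D0 c1 b0 *.
have : 0 <= (1 - r) * (r * (1 + c)) by rewrite !mulr_ge0//; lra.
nra.
Qed.

Lemma continuous_poisson (R : realType) (a : R[i]) (ta : R) :
  cabs a < 1 -> continuous (poisson_kernel a ta).
Proof.
move=> a1 t; rewrite /poisson_kernel.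
apply: cvgM; first exact: cvg_cst.
apply: cvgV; first by rewrite gt_eqF// poisson_den_gt0.
apply: cvgD; last exact: cvg_cst.
apply: cvgB; first exact: cvg_cst.
apply: cvgM; first exact: cvg_cst.
apply: (@continuous_comp _ _ _ (fun t : R => t - ta) (@cos R)).
  by apply: cvgB; [exact: cvg_id|exact: cvg_cst].
exact: continuous_cos.
Qed.

Lemma phase_branch_period (R : realType) (a : R[i]) (ta : R) :
  phase_branch a ta pi = phase_branch a ta (- pi) + 2 * pi.
Proof.
rewrite /phase_branch.
have -> : pi - ta = (- pi - ta) + pi *+ 2 :> R by ring.
by rewrite cosD2pi sinD2pi; ring.
Qed.

(** Two branches of the phase have the same exponential, so that frequencies
    cannot tell them apart. *)
Lemma expi_phaseMz (R : realType) (a : R[i]) (ta : R) (theta : R -> R)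
    (k : int) (t : R) :
  cabs a < 1 -> a = (cabs a)%:C * expi ta -> nonlinear_phase a theta ->
  expi (k%:~R * theta t) = expi (k%:~R * phase_branch a ta t).
Proof.
by move=> a1 aE [_ thetaE]; rewrite !expiMz thetaE expi_phase_branch.
Qed.

(** * Orthogonality *)

Lemma measurable_period (R : realType) :
  measurable (@period R : set (measurableTypeR R)).
Proof. exact: measurable_itv. Qed.

Local Notation period_integrable g :=
  ((@lebesgue_measure _).-integrable period (EFin \o g)).

Lemma continuous_integrable_period (R : realType) (g : R -> R) :
  continuous g -> period_integrable g.
Proof.
move=> cg; apply: continuous_compact_integrable; first exact: segment_compact.
exact: continuous_subspaceT.
Qed.

Lemma Rintegral_derive_period (R : realType) (F f : R -> R) :
  (forall t : R, is_derive t 1 F (f t)) -> continuous f ->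
  \int[@lebesgue_measure R]_(t in period) f t = F pi - F (- pi).
Proof.
move=> dF cf; rewrite /Rintegral /period.
have pi0 := pi_gt0 R.
have cF : continuous F.
  by move=> t; apply: differentiable_continuous; apply/derivable1_diffP;
    case: (dF t).
rewrite (@continuous_FTC2 _ f F) //.
- by lra.
- exact: continuous_subspaceT.
- split; first by move=> t _; case: (dF t).
  + by apply: cvg_at_right_filter; exact: cF.
  + by apply: cvg_at_left_filter; exact: cF.
- by move=> t _; rewrite derive1E; case: (dF t).
Qed.

(** Up to the factor [i k], the integrand is the derivative of
    [expi (k * theta)], which is [2 pi]-periodic; for [k = 0] it is the
    derivative of the phase itself, which increases by [2 pi] over a period. *)
Lemma Cintegral_expi_poisson (R : realType) (a : R[i]) (ta : R)
    (theta : R -> R) (k : int) :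
  cabs a < 1 -> a = (cabs a)%:C * expi ta -> nonlinear_phase a theta ->
  Cintegral period
    (fun t => expi (k%:~R * theta t) * (poisson_kernel a ta t)%:C) =
  (2 * pi)%:C * (k == 0)%:R.
Proof.
move=> a1 aE phase.
pose psi := phase_branch a ta; pose P := poisson_kernel a ta.
have dpsi (t : R) : is_derive t 1 psi (P t) by exact: is_derive_phase_branch.
have cP : continuous P by exact: continuous_poisson.
have cpsi : continuous psi.
  by move=> t; apply: differentiable_continuous; apply/derivable1_diffP;
    case: (dpsi t).
have -> : (fun t => expi (k%:~R * theta t) * (poisson_kernel a ta t)%:C) =
    (fun t => (cos (k%:~R * psi t) * P t) +i* (sin (k%:~R * psi t) * P t)).
  apply/funext => t; rewrite (expi_phaseMz _ _ a1 aE phase).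
  exact: mul_complex_real.
rewrite /Cintegral /=.
have [->|k0] := eqVneq k 0.
  under eq_Rintegral do rewrite mul0r cos0 mul1r.
  under [X in _ +i* X]eq_Rintegral do rewrite mul0r sin0 mul0r.
  rewrite (Rintegral_derive_period dpsi cP) /psi phase_branch_period.
  rewrite Rintegral_cst ?mul0r; last exact: measurable_period.
  by rewrite mulr1 addrAC subrr add0r.
have kR0 : k%:~R != 0 :> R by rewrite intr_eq0.
have per : expi (k%:~R * psi pi) = expi (k%:~R * psi (- pi)).
  by rewrite !expiMz /psi phase_branch_period expiD expi2pi mulr1.
have ck : continuous (fun t => k%:~R * psi t).
  by move=> t; apply: cvgM; [exact: cvg_cst|exact: cpsi].
have dS (t : R) : is_derive t 1 (fun s => k%:~R^-1 * sin (k%:~R * psi s))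
    (cos (k%:~R * psi t) * P t).
  by apply: is_derive_eq; rewrite /GRing.scale /=; field.
have dC (t : R) : is_derive t 1 (fun s => - (k%:~R^-1 * cos (k%:~R * psi s)))
    (sin (k%:~R * psi t) * P t).
  by apply: is_derive_eq; rewrite /GRing.scale /=; field.
have cc : continuous (fun t => cos (k%:~R * psi t) * P t).
  move=> t; apply: cvgM; last exact: cP.
  by apply: (continuous_comp (ck t)); exact: continuous_cos.
have cs : continuous (fun t => sin (k%:~R * psi t) * P t).
  move=> t; apply: cvgM; last exact: cP.
  by apply: (continuous_comp (ck t)); exact: continuous_sin.
rewrite (Rintegral_derive_period dS cc) (Rintegral_derive_period dC cs).
by case: per => -> ->; rewrite !subrr mulr0.
Qed.

(** * Integration of complex-valued functions over a period *)

Definition Cintegrable (R : realType) (g : R -> R[i]) : Prop :=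
  period_integrable (fun t => complex.Re (g t)) /\
  period_integrable (fun t => complex.Im (g t)).

Lemma integrable_addR (R : realType) (g h : R -> R) :
  period_integrable g -> period_integrable h ->
  period_integrable (fun t => g t + h t).
Proof.
move=> ig ih.
have := integrableD (@measurable_period R) ig ih.
by under eq_fun do rewrite -EFinD.
Qed.

Lemma integrable_mul_continuous (R : realType) (g h : R -> R) :
  period_integrable g -> continuous h ->
  period_integrable (fun t => g t * h t).
Proof.
move=> ig ch; apply: (integrableMl (@measurable_period R) ig).
  by apply: measurable_funTS; exact: continuous_measurable_fun.
have : bounded_set (h @` period).
  apply: compact_bounded.
  apply: continuous_compact; last exact: segment_compact.
  exact: continuous_subspaceT.
move=> [M [Mreal hM]]; exists M; split=> // x Mx t pt.
by apply: hM => //; exists t.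
Qed.

Lemma integrable_scaleR (R : realType) (r : R) (g : R -> R) :
  period_integrable g ->
  period_integrable (fun t => r * g t).
Proof.
move=> ig; rewrite (_ : (fun t => r * g t) = fun t => g t * r).
  by apply: integrable_mul_continuous => // t; exact: cvg_cst.
by apply/funext => t; rewrite mulrC.
Qed.

Lemma Cintegrable_mul_continuous (R : realType) (g h : R -> R[i]) :
  Cintegrable g -> continuous (fun t => complex.Re (h t)) ->
  continuous (fun t => complex.Im (h t)) ->
  Cintegrable (fun t => g t * h t).
Proof.
move=> [ir ii] cr ci; split.
- rewrite (_ : (fun t => complex.Re (g t * h t)) = fun t =>
    complex.Re (g t) * complex.Re (h t) +
    complex.Im (g t) * - complex.Im (h t)); last first.
    by apply/funext => t; rewrite ReM.
  apply: integrable_addR; apply: integrable_mul_continuous => //.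
  by move=> t; apply: cvgN; exact: ci.
- rewrite (_ : (fun t => complex.Im (g t * h t)) = fun t =>
    complex.Re (g t) * complex.Im (h t) +
    complex.Im (g t) * complex.Re (h t)); last first.
    by apply/funext => t; rewrite ImM.
  by apply: integrable_addR; apply: integrable_mul_continuous.
Qed.

Lemma CintegrableZ (R : realType) (c : R[i]) (g : R -> R[i]) :
  Cintegrable g -> Cintegrable (fun t => c * g t).
Proof.
move=> ig; rewrite (_ : (fun t => c * g t) = fun t => g t * c).
  by apply: Cintegrable_mul_continuous => // t; exact: cvg_cst.
by apply/funext => t; rewrite mulrC.
Qed.

Lemma CintegralZ (R : realType) (c : R[i]) (g : R -> R[i]) : Cintegrable g ->
  Cintegral period (fun t => c * g t) = c * Cintegral period g.
Proof.
have mp := @measurable_period R.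
case: c => x y [ir ii]; rewrite /Cintegral.
apply/eqP; rewrite eq_complex /=; apply/andP; split; apply/eqP.
- transitivity (\int[@lebesgue_measure R]_(t in period)
    (x * complex.Re (g t) + - y * complex.Im (g t))).
    by apply: eq_Rintegral => t _; case: (g t) => u v /=; rewrite mulNr.
  rewrite (RintegralD mp (integrable_scaleR _ ir) (integrable_scaleR _ ii)).
  by rewrite !RintegralZl// mulNr.
- transitivity (\int[@lebesgue_measure R]_(t in period)
    (x * complex.Im (g t) + y * complex.Re (g t))).
    by apply: eq_Rintegral => t _; case: (g t) => u v /=.
  rewrite (RintegralD mp (integrable_scaleR _ ii) (integrable_scaleR _ ir)).
  by rewrite !RintegralZl.
Qed.

Lemma Cintegrable0 (R : realType) : Cintegrable (fun _ : R => 0).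
Proof. by split; apply: continuous_integrable_period => t; exact: cvg_cst. Qed.

Lemma CintegrableD (R : realType) (g h : R -> R[i]) :
  Cintegrable g -> Cintegrable h -> Cintegrable (fun t => g t + h t).
Proof.
move=> [gr gi] [hr hi]; split.
  rewrite (_ : (fun t => complex.Re (g t + h t)) =
    fun t => complex.Re (g t) + complex.Re (h t)); first exact: integrable_addR.
  by apply/funext => t; case: (g t) (h t) => ? ? [].
rewrite (_ : (fun t => complex.Im (g t + h t)) =
  fun t => complex.Im (g t) + complex.Im (h t)); first exact: integrable_addR.
by apply/funext => t; case: (g t) (h t) => ? ? [].
Qed.

Lemma CintegralD (R : realType) (g h : R -> R[i]) :
  Cintegrable g -> Cintegrable h ->
  Cintegral period (fun t => g t + h t) =
  Cintegral period g + Cintegral period h.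
Proof.
have mp := @measurable_period R.
move=> [gr gi] [hr hi]; rewrite /Cintegral.
apply/eqP; rewrite eq_complex /= -(RintegralD mp gr hr) -(RintegralD mp gi hi).
by apply/andP; split; apply/eqP; apply: eq_Rintegral => t _;
  case: (g t) (h t) => ? ? [].
Qed.

Lemma Cintegrable_sum (R : realType) (n : nat) (g : 'I_n -> R -> R[i]) :
  (forall i, Cintegrable (g i)) -> Cintegrable (fun t => \sum_(i < n) g i t).
Proof.
move=> ig; elim: n g ig => [|n IH] g ig.
  under eq_fun do rewrite big_ord0.
  exact: Cintegrable0.
under eq_fun do rewrite big_ord_recr.
by apply: CintegrableD => //; exact: (IH (fun i => g (widen_ord (leqnSn n) i))).
Qed.

Lemma Cintegral_sum (R : realType) (n : nat) (g : 'I_n -> R -> R[i]) :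
  (forall i, Cintegrable (g i)) ->
  Cintegral period (fun t => \sum_(i < n) g i t) =
  \sum_(i < n) Cintegral period (g i).
Proof.
move=> ig; elim: n g ig => [|n IH] g ig.
  under eq_fun do rewrite big_ord0.
  rewrite big_ord0 /Cintegral /= Rintegral_cst ?mul0r//.
  exact: measurable_period.
under eq_fun do rewrite big_ord_recr.
rewrite /= CintegralD //; last first.
  by apply: Cintegrable_sum => i; exact: ig.
by rewrite big_ord_recr /= IH.
Qed.

Lemma measurable_normc (R : realType) (D : set (measurableTypeR R))
    (g : R -> R[i]) : measurable D ->
  measurable_fun D (fun t => complex.Re (g t)) ->
  measurable_fun D (fun t => complex.Im (g t)) ->
  measurable_fun D (fun t => cabs (g t)).
Proof.
move=> mD mr mi.
rewrite (_ : (fun t => cabs (g t)) = Num.sqrt \o (fun t =>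
  complex.Re (g t) ^+ 2 + complex.Im (g t) ^+ 2)); last first.
  by apply/funext => t; rewrite /= normcE.
apply: measurableT_comp.
  exact: (continuous_measurable_fun (@sqrt_continuous R)).
by apply: measurable_funD; exact: measurable_funX.
Qed.

Lemma integrable_normc (R : realType) (g : R -> R[i]) : Cintegrable g ->
  period_integrable (fun t => cabs (g t)).
Proof.
move=> [ir ii].
have ia (h : R -> R) : period_integrable h ->
    period_integrable (fun t => `|h t|).
  by move=> ih; exact: (integrable_abse ih).
have mr := measurable_int _ ir; have mi := measurable_int _ ii.
have mp := @measurable_period R.
apply: (le_integrable _ _ _ (integrable_addR (ia _ ir) (ia _ ii))) => //.
- apply/measurable_EFinP; apply: measurable_normc => //; exact/measurable_EFinP.
- move=> t _ /=; rewrite lee_fin [leLHS]ger0_norm ?normc_ge0//.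
  rewrite normcE -sqrtr_sqr ler_sqrt ?sqr_ge0//.
  rewrite -[X in X + _]real_normK ?num_real//.
  rewrite -[X in _ + X]real_normK ?num_real//.
  have := normr_ge0 (complex.Re (g t)); have := normr_ge0 (complex.Im (g t)).
  by nra.
Qed.

(** [I := Cintegral period g] satisfies
    [cabs I ^+ 2 = Re I * \int Re g + Im I * \int Im g], and the integrand
    [Re I * Re g + Im I * Im g] is at most [cabs I * cabs g]. *)
Lemma le_normc_Cintegral (R : realType) (g : R -> R[i]) : Cintegrable g ->
  cabs (Cintegral period g) <=
  \int[@lebesgue_measure R]_(t in period) cabs (g t).
Proof.
move=> ig; have [ir ii] := ig; have mp := @measurable_period R.
have ic := integrable_normc ig.
set I := Cintegral _ _.
have [->|I0] := eqVneq (cabs I) 0.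
  by apply: Rintegral_ge0 => t _; exact: normc_ge0.
have Igt0 : 0 < cabs I by rewrite lt_def I0 normc_ge0.
rewrite -(ler_pM2l Igt0) -expr2.
have -> : cabs I ^+ 2 = \int[@lebesgue_measure R]_(t in period)
    (complex.Re I * complex.Re (g t) + complex.Im I * complex.Im (g t)).
  rewrite (RintegralD mp (integrable_scaleR _ ir) (integrable_scaleR _ ii)).
  rewrite !RintegralZl//.
  by rewrite normcE sqr_sqrtr ?addr_ge0 ?sqr_ge0// /I /Cintegral /= !expr2.
rewrite -RintegralZl//; apply: le_Rintegral => //.
- exact: integrable_addR (integrable_scaleR _ ir) (integrable_scaleR _ ii).
- exact: integrable_scaleR.
move=> t _; rewrite -Normc.normcM.
have -> : complex.Re I * complex.Re (g t) + complex.Im I * complex.Im (g t) =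
    complex.Re (conjc I * g t).
  by case: (I) (g t) => x y [u v] /=; ring.
apply: le_trans (ler_norm _) (le_trans (normr_Re_le _) _).
by rewrite !Normc.normcM; case: (I) => x y /=; rewrite sqrrN.
Qed.

(** * The Fejer kernel *)

(** By induction on [n]: [z ^+ n] times the Dirichlet kernel of order [n] is the
    geometric sum of the [z ^+ j] for [j <= 2 n]; split before [j = n] and after
    it, this sum matches the three new terms of the product, because reversing
    the order of summation gives
    [z ^+ n * \sum_(k < n) z ^- k = z * \sum_(k < n) z ^+ k]. *)
Lemma sum_dirichlet_kernels (F : fieldType) (z : F) (n : nat) : z != 0 ->
  \sum_(k < n) \sum_(j < k.*2.+1) z ^ (j%:Z - k%:Z) =
  (\sum_(k < n) z ^+ k) * (\sum_(k < n) z ^- k).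
Proof.
move=> z0.
have rev m : z ^+ m * (\sum_(k < m) z ^- k) = z * \sum_(k < m) z ^+ k.
  elim: m => [|m IH]; first by rewrite !big_ord0 !mulr0.
  rewrite big_ord_recr big_ord_recl /= mulrDr exprS -mulrA -[in LHS]mulrA IH.
  rewrite mulfV ?expf_neq0// mulr1 expr0 mulrDr mulr1 addrC; congr (_ + _).
  by congr (_ * _); rewrite mulr_sumr; apply: eq_bigr => i _; rewrite -exprS.
elim: n => [|n IH]; first by rewrite !big_ord0 mulr0.
have zn0 : z ^+ n != 0 by rewrite expf_neq0.
rewrite big_ord_recr /= IH.
rewrite [X in _ = X * _]big_ord_recr [X in _ = _ * X]big_ord_recr /=.
set A := \sum_(k < n) z ^+ k; set B := \sum_(k < n) z ^- k.
have dirichlet : \sum_(j < n.*2.+1) z ^ (j%:Z - n%:Z) =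
    (A + z ^+ n * (1 + z * A)) / z ^+ n.
  have -> : \sum_(j < n.*2.+1) z ^ (j%:Z - n%:Z) =
      (\sum_(j < n + n.+1) z ^+ j) / z ^+ n.
    rewrite addnS addnn mulr_suml; apply: eq_bigr => j _.
    by rewrite expfzDr// exprnN.
  congr (_ / _); rewrite big_split_ord /=; congr (_ + _).
  rewrite big_ord_recl mulrDr mulr1; congr (_ + _); first by rewrite /= addn0.
  rewrite /A !mulr_sumr; apply: eq_bigr => i _.
  by rewrite /= -exprS -exprD.
rewrite dirichlet.
transitivity (A * B + A / z ^+ n + z ^+ n * B + 1).
  by rewrite (rev n : z ^+ n * B = z * A); field.
by field.
Qed.

(** The squared modulus of [\sum_(k < n.+1) expi (k * s)], divided by [n.+1]:
    a form that shows positivity at once. *)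
Definition fejer_kernel (R : realType) (n : nat) (s : R) : R :=
  n.+1%:R^-1 * ((\sum_(k < n.+1) cos (k%:R * s)) ^+ 2 +
                (\sum_(k < n.+1) sin (k%:R * s)) ^+ 2).

Lemma fejer_kernel_ge0 (R : realType) (n : nat) (s : R) : 0 <= fejer_kernel n s.
Proof. by rewrite mulr_ge0 ?invr_ge0 ?addr_ge0 ?sqr_ge0. Qed.

Lemma continuous_fejer_kernel (R : realType) (n : nat) :
  continuous (@fejer_kernel R n).
Proof.
have csum (h : R -> R) (m : nat) : continuous h ->
    continuous (fun s : R => \sum_(k < m) h (k%:R * s)).
  move=> ch; elim: m => [|m IH] s.
    by under eq_fun do rewrite big_ord0; exact: cvg_cst.
  under eq_fun do rewrite big_ord_recr.
  apply: cvgD; first exact: IH.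
  apply: (@continuous_comp _ _ _ (fun s : R => m%:R * s) h); last exact: ch.
  by apply: cvgM; [exact: cvg_cst|exact: cvg_id].
move=> s; apply: cvgM; first exact: cvg_cst.
by apply: cvgD; apply: cvgM; apply: csum;
  (exact: continuous_cos || exact: continuous_sin).
Qed.

Lemma fejer_kernelE (R : realType) (n : nat) (s : R) :
  (fejer_kernel n s)%:C =
  n.+1%:R^-1 * \sum_(k < n.+1) \sum_(j < k.*2.+1) expi ((j%:Z - k%:Z)%:~R * s).
Proof.
under eq_bigr do under eq_bigr do rewrite expiMz.
rewrite sum_dirichlet_kernels; last exact: expi_neq0.
have -> : \sum_(k < n.+1) expi s ^+ k =
    (\sum_(k < n.+1) cos (k%:R * s)) +i* (\sum_(k < n.+1) sin (k%:R * s)).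
  by elim/big_rec3: _ => // k x y _ _ ->; rewrite -expiMn.
have -> : \sum_(k < n.+1) expi s ^- k =
    (\sum_(k < n.+1) cos (k%:R * s)) -i* (\sum_(k < n.+1) sin (k%:R * s)).
  elim/big_rec3: _ => [|k x y _ _ ->]; first by rewrite oppr0.
  rewrite -expiMn -expiN /expi cosN sinN.
  by apply/eqP; rewrite eq_complex /= opprD !eqxx.
rewrite /fejer_kernel; set X := \sum_(k < _) _; set Y := \sum_(k < _) _.
have -> : n.+1%:R^-1 = (n.+1%:R^-1)%:C :> R[i] by rewrite fmorphV rmorph_nat.
rewrite [RHS]mulrC mul_complex_real /=.
by apply/eqP; rewrite eq_complex /=; apply/andP; split; apply/eqP; ring.
Qed.

(** * The Fejer mean as an average *)

Lemma Cintegrable_coef (R : realType) (a : R[i]) (ta : R) (theta : R -> R)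
    (f : R -> R[i]) (k : int) :
  cabs a < 1 -> continuous theta -> Cintegrable f ->
  Cintegrable
    (fun t => f t * expi (- (k%:~R * theta t)) * (poisson_kernel a ta t)%:C).
Proof.
move=> a1 ctheta fi.
apply: (Cintegrable_mul_continuous (h := fun t => (poisson_kernel a ta t)%:C)).
- have [ce se] :
      continuous (fun t => complex.Re (expi (- (k%:~R * theta t)))) /\
      continuous (fun t => complex.Im (expi (- (k%:~R * theta t)))).
    apply: continuous_expi_comp => t; apply: cvgN.
    by apply: cvgM; [exact: cvg_cst|exact: ctheta].
  exact: Cintegrable_mul_continuous.
- exact: continuous_poisson.
- by move=> t; exact: cvg_cst.
Qed.

(** Summing the Fourier coefficients under the integral sign turns the mean
    into an average of [f] against a nonnegative kernel. *)
Lemma fejer_mean_kernel (R : realType) (a : R[i]) (ta : R) (theta : R -> R)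
    (f : R -> R[i]) (n : nat) (x : R) :
  cabs a < 1 -> continuous theta -> Cintegrable f ->
  fejer_mean a ta theta f n x = ((2 * pi)^-1)%:C *
    Cintegral period (fun t => f t *
      (poisson_kernel a ta t * fejer_kernel n (theta x - theta t))%:C).
Proof.
move=> a1 ctheta fi.
pose g (m : int) t :=
  f t * expi (- (m%:~R * theta t)) * (poisson_kernel a ta t)%:C.
have gi m : Cintegrable (g m) by exact: Cintegrable_coef.
have -> : (fun t => f t *
      (poisson_kernel a ta t * fejer_kernel n (theta x - theta t))%:C) =
    (fun t => n.+1%:R^-1 * \sum_(k < n.+1) \sum_(j < k.*2.+1)
      expi ((j%:Z - k%:Z)%:~R * theta x) * g (j%:Z - k%:Z) t).
  apply/funext => t; rewrite rmorphM /= fejer_kernelE mulrA mulrCA.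
  congr (_ * _).
  rewrite mulr_sumr; apply: eq_bigr => k _.
  rewrite mulr_sumr; apply: eq_bigr => j _.
  by rewrite mulrBr expiD /g; ring.
have gZi (m : int) : Cintegrable (fun t => expi (m%:~R * theta x) * g m t).
  exact: CintegrableZ.
rewrite CintegralZ; last first.
  by apply: Cintegrable_sum => k; apply: Cintegrable_sum => j; exact: gZi.
rewrite Cintegral_sum; last first.
  by move=> k; apply: Cintegrable_sum => j; exact: gZi.
rewrite /fejer_mean mulrCA; congr (_ * _).
rewrite mulr_sumr; apply: eq_bigr => k _.
rewrite Cintegral_sum// mulr_sumr; apply: eq_bigr => j _.
by rewrite CintegralZ// /coef mulrAC -mulrA.
Qed.

Lemma coef0E (R : realType) (a : R[i]) (ta : R) (theta : R -> R)
    (f : R -> R[i]) :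
  (2 * pi)%:C * coef a ta theta f 0 =
  Cintegral period (fun t => f t * (poisson_kernel a ta t)%:C).
Proof.
rewrite /coef mulrA -rmorphM /= divff ?mulf_neq0 ?pnatr_eq0 ?gt_eqF ?pi_gt0//.
rewrite mul1r; congr Cintegral; apply/funext => t.
by rewrite mul0r oppr0 expi0 mulr1.
Qed.

Lemma sum_frequency0 (R : realType) (F : int -> R[i]) (k : nat) :
  \sum_(j < k.*2.+1) F (j%:Z - k%:Z) * (j%:Z - k%:Z == 0)%:R = F 0.
Proof.
have kk : (k < k.*2.+1)%N by rewrite ltnS -addnn leq_addr.
rewrite (bigD1 (Ordinal kk)) //= subrr eqxx mulr1 big1 ?addr0// => j jk.
rewrite subr_eq0 eqz_nat (_ : (j == k :> nat) = false) ?mulr0//.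
by apply: contraNF jk => /eqP jk; apply/eqP/val_inj.
Qed.

Lemma fejer_mean1 (R : realType) (a : R[i]) (ta : R) (theta : R -> R)
    (n : nat) (x : R) :
  cabs a < 1 -> a = (cabs a)%:C * expi ta -> nonlinear_phase a theta ->
  fejer_mean a ta theta (fun=> 1) n x = 1.
Proof.
move=> a1 aE phase.
have coef1 m : coef a ta theta (fun=> 1) m = (m == 0)%:R.
  rewrite /coef.
  under eq_fun do rewrite mul1r -mulNr -mulrNz.
  rewrite (Cintegral_expi_poisson _ a1 aE phase) oppr_eq0 mulrA -rmorphM /=.
  by rewrite mulVf ?mul1r// mulf_neq0 ?pnatr_eq0 ?gt_eqF ?pi_gt0.
have ps k : partial_sum a ta theta (fun=> 1) k x = 1.
  rewrite /partial_sum -[RHS](@expi0 R).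
  rewrite -[in RHS](mul0r (theta x)).
  rewrite -(sum_frequency0 (fun m => expi (m%:~R * theta x)) k).
  by apply: eq_bigr => j _; rewrite coef1 mulrC.
rewrite /fejer_mean; under eq_bigr do rewrite ps.
by rewrite sumr_const card_ord mulVf// pnatr_eq0.
Qed.

Lemma continuous_fejer_mean (R : realType) (a : R[i]) (ta : R)
    (theta : R -> R) (f : R -> R[i]) (n : nat) : continuous theta ->
  continuous (fun x => complex.Re (fejer_mean a ta theta f n x)) /\
  continuous (fun x => complex.Im (fejer_mean a ta theta f n x)).
Proof.
move=> ctheta.
pose Ccont (h : R -> R[i]) := continuous (fun x => complex.Re (h x)) /\
  continuous (fun x => complex.Im (h x)).
have contZ (c : R[i]) h : Ccont h -> Ccont (fun x => c * h x).
  move=> [hr hi]; split => x.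
    under eq_fun do rewrite ReM.
    by apply: cvgD; apply: cvgM; [exact: cvg_cst|exact: hr|exact: cvg_cst|
      apply: cvgN; exact: hi].
  under eq_fun do rewrite ImM.
  by apply: cvgD; apply: cvgM; [exact: cvg_cst|exact: hi|exact: cvg_cst|
    exact: hr].
have contS m (h : nat -> R -> R[i]) : (forall i, Ccont (h i)) ->
    Ccont (fun x => \sum_(i < m) h i x).
  move=> hc; elim: m => [|m [IHr IHi]].
    by split => x; under eq_fun do rewrite big_ord0 /=; exact: cvg_cst.
  have [hr hi] := hc m; split => x.
    under eq_fun do rewrite big_ord_recr raddfD.
    by apply: cvgD; [exact: IHr|exact: hr].
  under eq_fun do rewrite big_ord_recr raddfD.
  by apply: cvgD; [exact: IHi|exact: hi].
apply: (contZ); apply: (contS _ (fun k x => partial_sum a ta theta f k x)) => k.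
apply: (contS _ (fun j x => coef a ta theta f (j%:Z - k%:Z) *
  expi ((j%:Z - k%:Z)%:~R * theta x))) => j.
apply: (contZ); apply: continuous_expi_comp => x.
by apply: cvgM; [exact: cvg_cst|exact: ctheta].
Qed.

(** By orthogonality only the coefficient of frequency zero is left of the
    trigonometric polynomial, and it occurs once in each partial sum. *)
Lemma Cintegral_fejer_mean (R : realType) (a : R[i]) (ta : R)
    (theta : R -> R) (f : R -> R[i]) (n : nat) :
  cabs a < 1 -> a = (cabs a)%:C * expi ta -> nonlinear_phase a theta ->
  Cintegral period
    (fun x => fejer_mean a ta theta f n x * (poisson_kernel a ta x)%:C) =
  Cintegral period (fun t => f t * (poisson_kernel a ta t)%:C).
Proof.
move=> a1 aE phase; have [ctheta _] := phase.
pose e (m : int) x := expi (m%:~R * theta x) * (poisson_kernel a ta x)%:C.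
have ei m : Cintegrable (e m).
  have one : Cintegrable (fun _ : R => 1).
    by split; apply: continuous_integrable_period => t; exact: cvg_cst.
  have := Cintegrable_coef ta (- m) a1 ctheta one.
  by under eq_fun do rewrite mul1r mulrNz mulNr opprK.
have -> : (fun x => fejer_mean a ta theta f n x * (poisson_kernel a ta x)%:C) =
    (fun x => n.+1%:R^-1 * \sum_(k < n.+1) \sum_(j < k.*2.+1)
      coef a ta theta f (j%:Z - k%:Z) * e (j%:Z - k%:Z) x).
  apply/funext => x; rewrite /fejer_mean -mulrA; congr (_ * _).
  rewrite mulr_suml; apply: eq_bigr => k _.
  by rewrite mulr_suml; apply: eq_bigr => j _; rewrite mulrA.
have eZi (m : int) : Cintegrable (fun x => coef a ta theta f m * e m x).
  exact: CintegrableZ.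
rewrite CintegralZ; last first.
  by apply: Cintegrable_sum => k; apply: Cintegrable_sum => j; exact: eZi.
rewrite Cintegral_sum; last first.
  by move=> k; apply: Cintegrable_sum => j; exact: eZi.
rewrite -(coef0E a ta theta).
under eq_bigr => k _.
  rewrite Cintegral_sum//.
  under eq_bigr => j _.
    rewrite CintegralZ// (Cintegral_expi_poisson _ a1 aE phase) mulrA.
    over.
  rewrite (sum_frequency0 (fun m => coef a ta theta f m * (2 * pi)%:C)).
  over.
by rewrite sumr_const card_ord -[X in _ * X]mulr_natl mulKf ?pnatr_eq0// mulrC.
Qed.

(** The Fejer mean of a real-valued [u], as a real number: the form on which
    positivity can be used. *)
Definition fejer_average (R : realType) (a : R[i]) (ta : R) (theta : R -> R)
    (u : R -> R) (n : nat) (x : R) : R :=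
  (2 * pi)^-1 * \int[@lebesgue_measure R]_(t in period)
    (u t * (poisson_kernel a ta t * fejer_kernel n (theta x - theta t))).

Lemma continuous_kernel_weight (R : realType) (a : R[i]) (ta : R)
    (theta : R -> R) (n : nat) (x : R) : cabs a < 1 -> continuous theta ->
  continuous
    (fun t => poisson_kernel a ta t * fejer_kernel n (theta x - theta t)).
Proof.
move=> a1 ctheta t; apply: cvgM; first exact: continuous_poisson.
apply: (@continuous_comp _ _ _ (fun t => theta x - theta t) (fejer_kernel n)).
  by apply: cvgB; [exact: cvg_cst|exact: ctheta].
exact: continuous_fejer_kernel.
Qed.

Lemma fejer_mean_real (R : realType) (a : R[i]) (ta : R)
    (theta : R -> R) (u : R -> R) (n : nat) (x : R) :
  cabs a < 1 -> continuous theta ->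
  period_integrable u ->
  fejer_mean a ta theta (fun t => (u t)%:C) n x =
  (fejer_average a ta theta u n x)%:C.
Proof.
move=> a1 ctheta ui; rewrite fejer_mean_kernel//; last first.
  by split=> //; apply: continuous_integrable_period => t; exact: cvg_cst.
rewrite rmorphM /=; congr (_ * _); rewrite /Cintegral.
congr Complex.
  by apply: eq_Rintegral => t _; rewrite mul_complex_real.
under eq_Rintegral do rewrite mul_complex_real /= mul0r.
by rewrite Rintegral_cst ?mul0r//; exact: measurable_period.
Qed.

Lemma fejer_average1 (R : realType) (a : R[i]) (ta : R) (theta : R -> R)
    (n : nat) (x : R) :
  cabs a < 1 -> a = (cabs a)%:C * expi ta -> nonlinear_phase a theta ->
  fejer_average a ta theta (fun=> 1) n x = 1.
Proof.
move=> a1 aE phase; have [ctheta _] := phase; apply: complexI.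
rewrite -fejer_mean_real ?fejer_mean1//.
by apply: continuous_integrable_period => t; exact: cvg_cst.
Qed.

Lemma le_fejer_average (R : realType) (a : R[i]) (ta : R) (theta : R -> R)
    (u v : R -> R) (n : nat) (x : R) :
  cabs a < 1 -> continuous theta ->
  period_integrable u -> period_integrable v ->
  (forall t, u t <= v t) ->
  fejer_average a ta theta u n x <= fejer_average a ta theta v n x.
Proof.
move=> a1 ctheta ui vi uv.
have cw := @continuous_kernel_weight R a ta theta n x a1 ctheta.
rewrite /fejer_average ler_wpM2l//.
  by rewrite invr_ge0 mulr_ge0// pi_ge0.
apply: le_Rintegral; first exact: measurable_period.
- exact: integrable_mul_continuous.
- exact: integrable_mul_continuous.
- by move=> t _; rewrite ler_wpM2r// mulr_ge0 ?poisson_ge0 ?fejer_kernel_ge0.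
Qed.

Lemma fejer_average_affine (R : realType) (a : R[i]) (ta : R)
    (theta : R -> R) (u : R -> R) (c d : R) (n : nat) (x : R) :
  cabs a < 1 -> a = (cabs a)%:C * expi ta -> nonlinear_phase a theta ->
  period_integrable u ->
  fejer_average a ta theta (fun t => c + d * u t) n x =
  c + d * fejer_average a ta theta u n x.
Proof.
move=> a1 aE phase ui; have [ctheta _] := phase.
have cw := @continuous_kernel_weight R a ta theta n x a1 ctheta.
have mp := @measurable_period R.
rewrite -[in RHS](mulr1 c) -(fejer_average1 n x a1 aE phase) /fejer_average.
set w := fun t => _ in cw.
have i1 : period_integrable (fun t => 1 * w t).
  apply: integrable_mul_continuous => //.
  by apply: continuous_integrable_period => t; exact: cvg_cst.
have iu : period_integrable (fun t => u t * w t).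
  exact: integrable_mul_continuous.
transitivity ((2 * pi)^-1 * \int[@lebesgue_measure R]_(t in period)
    (c * (1 * w t) + d * (u t * w t))).
  by congr (_ * _); apply: eq_Rintegral => t _; rewrite /w; ring.
rewrite (RintegralD mp (integrable_scaleR _ i1) (integrable_scaleR _ iu)).
by rewrite (RintegralZl _ mp i1) (RintegralZl _ mp iu) /w; ring.
Qed.

(** * Jensen's inequality *)

(** Young's inequality for [y] and [m `^ (p - 1)] is the tangent-line form of
    the convexity of [y `^ p]. *)
Lemma powR_tangent (R : realType) (p m y : R) : 1 <= p -> 0 <= m -> 0 <= y ->
  m `^ p + p * m `^ (p - 1) * (y - m) <= y `^ p.
Proof.
rewrite le_eqVlt => /predU1P[<-|p1] m0 y0.
  by rewrite subrr powRr0 !powRr1//; lra.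
have p0 : 0 < p by lra.
have q0 : 0 < p / (p - 1) by rewrite divr_gt0// subr_gt0.
have pB0 : p - 1 != 0 by rewrite subr_eq0 gt_eqF.
have pq : p^-1 + (p / (p - 1))^-1 = 1 by field; rewrite pB0 gt_eqF.
have := conjugate_powR y0 (powR_ge0 m (p - 1)) p0 q0 pq.
rewrite -powRrM mulrCA divff// mulr1 -(ler_pM2l p0).
have -> : p * (y `^ p / p + m `^ p / (p / (p - 1))) =
    y `^ p + (p - 1) * m `^ p.
  by field; rewrite pB0 gt_eqF.
rewrite -(mulr_powRB1 m0 p0); nra.
Qed.

(** The tangent line to [y `^ p] at [m := fejer_average u x] is an affine
    minorant whose average, the weight having mass one, is [m `^ p]. *)
Lemma fejer_average_jensen (R : realType) (a : R[i]) (ta : R)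
    (theta : R -> R) (u : R -> R) (p : R) (n : nat) (x : R) :
  cabs a < 1 -> a = (cabs a)%:C * expi ta -> nonlinear_phase a theta ->
  1 <= p -> (forall t, 0 <= u t) ->
  period_integrable u ->
  period_integrable (fun t => u t `^ p) ->
  fejer_average a ta theta u n x `^ p <=
  fejer_average a ta theta (fun t => u t `^ p) n x.
Proof.
move=> a1 aE phase p1 u0 ui upi; have [ctheta _] := phase.
set m := fejer_average a ta theta u n x.
have m0 : 0 <= m.
  rewrite /m /fejer_average mulr_ge0 ?invr_ge0 ?mulr_ge0 ?pi_ge0//.
  apply: Rintegral_ge0 => t _.
  by apply: mulr_ge0 => //; rewrite mulr_ge0// ?poisson_ge0 ?fejer_kernel_ge0.
pose d := p * m `^ (p - 1).
have -> : m `^ p =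
    fejer_average a ta theta (fun t => m `^ p - d * m + d * u t) n x.
  by rewrite fejer_average_affine// subrK.
apply: le_fejer_average => //.
  apply: integrable_addR.
    by apply: continuous_integrable_period => t; exact: cvg_cst.
  exact: integrable_scaleR.
move=> t; apply: le_trans (powR_tangent p1 m0 (u0 t)).
by rewrite -/d; lra.
Qed.

Lemma normc_fejer_mean_le (R : realType) (a : R[i]) (ta : R)
    (theta : R -> R) (f : R -> R[i]) (n : nat) (x : R) :
  cabs a < 1 -> continuous theta -> Cintegrable f ->
  cabs (fejer_mean a ta theta f n x) <=
  fejer_average a ta theta (fun t => cabs (f t)) n x.
Proof.
move=> a1 ctheta fi.
have cw := @continuous_kernel_weight R a ta theta n x a1 ctheta.
have creal (r : R) : 0 <= r -> cabs (r%:C) = r.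
  by move=> r0; rewrite /= expr0n addr0 sqrtr_sqr ger0_norm.
have pi2 : 0 <= (2 * pi : R)^-1 by rewrite invr_ge0 mulr_ge0 ?pi_ge0.
rewrite fejer_mean_kernel// Normc.normcM creal// /fejer_average ler_wpM2l//.
apply: le_trans (le_normc_Cintegral _) _.
  apply: (Cintegrable_mul_continuous (h := fun t => (poisson_kernel a ta t *
    fejer_kernel n (theta x - theta t))%:C)) => // t; exact: cvg_cst.
rewrite le_eqVlt; apply/orP; left; apply/eqP; apply: eq_Rintegral => t _.
by rewrite Normc.normcM creal// mulr_ge0 ?poisson_ge0 ?fejer_kernel_ge0.
Qed.

(** * The bound in L^p *)

Lemma normLp_Rintegral (R : realType) (p : R) (f : R -> R[i]) :
  period_integrable (fun t => cabs (f t) `^ p) ->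
  normLp p f = (((2 * pi)^-1 *
    \int[@lebesgue_measure R]_(t in period) (cabs (f t) `^ p)) `^ p^-1)%:E.
Proof.
move=> fi; rewrite /normLp -poweR_EFin EFinM; congr ((_ * _) `^ _)%E.
rewrite /Rintegral fineK//.
exact: (integrable_fin_num (@measurable_period R) fi).
Qed.

Lemma measurable_normc_powR (R : realType) (p : R) (f : R -> R[i]) :
  measurable_fun [set: R] (fun t => complex.Re (f t)) ->
  measurable_fun [set: R] (fun t => complex.Im (f t)) ->
  measurable_fun (@period R : set (measurableTypeR R))
    (fun t => cabs (f t) `^ p).
Proof.
move=> mr mi; apply: measurable_funTS.
apply: (measurableT_comp (measurable_powR p)).
exact: (measurable_normc measurableT mr mi).
Qed.

Lemma mem_Lp_integrable_powR (R : realType) (p : R) (f : R -> R[i]) :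
  0 < p -> mem_Lp p f ->
  period_integrable (fun t => cabs (f t) `^ p).
Proof.
move=> p0 [_ mr mi]; rewrite /normLp => fin.
have pi2 : 0 < (2 * pi : R)^-1 by rewrite invr_gt0 mulr_gt0 ?pi_gt0.
apply/integrableP; split.
  by apply/measurable_EFinP; exact: measurable_normc_powR.
under eq_integral do rewrite /= ger0_norm ?powR_ge0//.
rewrite ltey; apply/eqP => intE; move: fin.
by rewrite intE gt0_muley ?lte_fin// poweRyr ?ltxx// invr_eq0 gt_eqF.
Qed.

(** The period has finite measure and [y <= 1 + y `^ p]. *)
Lemma mem_Lp_Cintegrable (R : realType) (p : R) (f : R -> R[i]) :
  1 <= p -> mem_Lp p f -> Cintegrable f.
Proof.
move=> p1 Lf; have p0 : 0 < p by exact: lt_le_trans p1.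
have [_ mr mi _] := Lf; have fi := mem_Lp_integrable_powR p0 Lf.
have one : period_integrable (fun=> 1 : R).
  by apply: continuous_integrable_period => t; exact: cvg_cst.
have le_powR (y : R) : 0 <= y -> y <= 1 + y `^ p.
  move=> y0; have := powR_ge0 y p.
  have [y1|y1] := leP y 1; first lra.
  have := powR_tangent p1 ler01 y0; rewrite !powR1; nra.
have i1f := integrable_addR one fi.
split; apply: (le_integrable (@measurable_period R) _ _ i1f).
- by apply/measurable_EFinP; exact: measurable_funTS.
- move=> t _ /=; rewrite lee_fin [leRHS]ger0_norm ?addr_ge0 ?powR_ge0//.
  by apply: le_trans (normr_Re_le _) _; rewrite le_powR ?normc_ge0.
- by apply/measurable_EFinP; exact: measurable_funTS.
- move=> t _ /=; rewrite lee_fin [leRHS]ger0_norm ?addr_ge0 ?powR_ge0//.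
  by apply: le_trans (normr_Im_le _) _; rewrite le_powR ?normc_ge0.
Qed.

Lemma continuous_fejer_average (R : realType) (a : R[i]) (ta : R)
    (theta : R -> R) (u : R -> R) (n : nat) :
  cabs a < 1 -> continuous theta ->
  period_integrable u ->
  continuous (fejer_average a ta theta u n).
Proof.
move=> a1 ctheta ui.
rewrite (_ : fejer_average a ta theta u n =
  fun x => complex.Re (fejer_mean a ta theta (fun t => (u t)%:C) n x)).
  exact: (continuous_fejer_mean a ta _ n ctheta).1.
by apply/funext => x; rewrite fejer_mean_real.
Qed.

Lemma Rintegral_fejer_average (R : realType) (a : R[i]) (ta : R)
    (theta : R -> R) (u : R -> R) (n : nat) :
  cabs a < 1 -> a = (cabs a)%:C * expi ta -> nonlinear_phase a theta ->
  period_integrable u ->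
  \int[@lebesgue_measure R]_(x in period)
    (fejer_average a ta theta u n x * poisson_kernel a ta x) =
  \int[@lebesgue_measure R]_(t in period) (u t * poisson_kernel a ta t).
Proof.
move=> a1 aE phase ui; have [ctheta _] := phase.
have Re_Cintegral (g : R -> R[i]) : complex.Re (Cintegral period g) =
    \int[@lebesgue_measure R]_(t in period) complex.Re (g t) by [].
have /(congr1 (@complex.Re R)) :=
  Cintegral_fejer_mean (fun t => (u t)%:C) n a1 aE phase.
rewrite !Re_Cintegral => intE.
transitivity (\int[@lebesgue_measure R]_(x in period) complex.Re
    (fejer_mean a ta theta (fun t => (u t)%:C) n x *
     (poisson_kernel a ta x)%:C)).
  by apply: eq_Rintegral => x _; rewrite mul_complex_real fejer_mean_real.
by rewrite intE; apply: eq_Rintegral => t _; rewrite mul_complex_real.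
Qed.

(** One factor [C := (1 + cabs a) / (1 - cabs a)] is lost in [1 <= C * P] to
    introduce the Poisson weight [P], for which the mean preserves integrals,
    and the other one in [P <= C] to remove it. *)
Lemma Rintegral_fejer_mean_powR_le (R : realType) (a : R[i]) (ta : R)
    (theta : R -> R) (f : R -> R[i]) (p : R) (n : nat) :
  cabs a < 1 -> a = (cabs a)%:C * expi ta -> nonlinear_phase a theta ->
  1 <= p -> mem_Lp p f ->
  period_integrable (fun x => cabs (fejer_mean a ta theta f n x) `^ p) /\
  \int[@lebesgue_measure R]_(x in period)
    (cabs (fejer_mean a ta theta f n x) `^ p) <=
  ((1 + cabs a) / (1 - cabs a)) ^+ 2 *
  \int[@lebesgue_measure R]_(t in period) (cabs (f t) `^ p).
Proof.
move=> a1 aE phase p1 Lf; have [ctheta _] := phase.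
have p0 : 0 < p by exact: lt_le_trans p1.
have mp := @measurable_period R.
have fi := mem_Lp_Cintegrable p1 Lf; have upi := mem_Lp_integrable_powR p0 Lf.
have ui := integrable_normc fi.
pose u t := cabs (f t); pose up t := u t `^ p.
pose M := fejer_average a ta theta up n.
set C := (1 + cabs a) / (1 - cabs a).
have C0 : 0 <= C.
  by apply: divr_ge0; have := normc_ge0 a; lra.
have cM : continuous M by exact: continuous_fejer_average.
have iM := continuous_integrable_period cM.
have cP := @continuous_poisson R a ta a1.
have le_sigma x : cabs (fejer_mean a ta theta f n x) `^ p <= M x.
  apply: (@le_trans _ _ (fejer_average a ta theta u n x `^ p)).
    apply: ge0_ler_powR; rewrite ?nnegrE ?normc_ge0 ?(ltW p0)//.
      exact: le_trans (normc_ge0 _) (normc_fejer_mean_le ta n x a1 ctheta fi).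
    exact: normc_fejer_mean_le.
  by apply: fejer_average_jensen => // t; exact: normc_ge0.
have M0 x : 0 <= M x by exact: le_trans (powR_ge0 _ _) (le_sigma x).
have isigma :
    period_integrable (fun x => cabs (fejer_mean a ta theta f n x) `^ p).
  apply: (le_integrable mp _ _ iM).
    apply/measurable_EFinP; apply: measurable_normc_powR;
      apply: continuous_measurable_fun;
      by have [] := continuous_fejer_mean a ta f n ctheta.
  by move=> x _ /=; rewrite lee_fin !ger0_norm ?powR_ge0.
split=> //.
have iMP : period_integrable (fun x => M x * poisson_kernel a ta x).
  exact: integrable_mul_continuous.
have iuP : period_integrable (fun x => up x * poisson_kernel a ta x).
  exact: integrable_mul_continuous.
apply: (@le_trans _ _ (\int[@lebesgue_measure R]_(x in period)
    (C * (M x * poisson_kernel a ta x)))).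
  apply: le_Rintegral => //; first exact: integrable_scaleR.
  move=> x _; apply: le_trans (le_sigma x) _.
  by rewrite mulrCA -[leLHS]mulr1 ler_wpM2l// poisson_ge.
rewrite RintegralZl// Rintegral_fejer_average// expr2 -mulrA ler_wpM2l//.
rewrite -RintegralZl//.
apply: le_Rintegral => //; first exact: integrable_scaleR.
by move=> t _; rewrite mulrC ler_wpM2r ?powR_ge0// poisson_le.
Qed.

Theorem theorem9 (R : realType) (a : R[i]) (ta : R) (theta : R -> R) (p : R)
    (a_lt1 : cabs a < 1)
    (argE : a = (cabs a)%:C * expi ta)
    (phase : nonlinear_phase a theta)
    (p_ge1 : 1 <= p)
    (f : R -> R[i]) (Lpf : mem_Lp p f) (n : nat) :
  (normLp p (fejer_mean a ta theta f n) <=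
   (((1 + cabs a) / (1 - cabs a)) `^ (2 / p))%:E * normLp p f)%E.
Proof.
have p0 : 0 < p by exact: lt_le_trans p_ge1.
have [isigma le_int] :=
  Rintegral_fejer_mean_powR_le n a_lt1 argE phase p_ge1 Lpf.
rewrite !normLp_Rintegral//; last exact: mem_Lp_integrable_powR.
set C := (1 + cabs a) / (1 - cabs a) in le_int *.
have C0 : 0 <= C.
  by apply: divr_ge0; have := normc_ge0 a; lra.
move: C C0 le_int => C C0 le_int.
have pi2 : 0 <= (2 * pi : R)^-1 by rewrite invr_ge0 mulr_ge0 ?pi_ge0.
have int0 (g : R -> R[i]) :
    0 <= \int[@lebesgue_measure R]_(t in period) (cabs (g t) `^ p).
  by apply: Rintegral_ge0 => t _; exact: powR_ge0.
rewrite -EFinM lee_fin powRrM -[2]/(2%:R) powR_mulrn//.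
rewrite -powRM ?exprn_ge0 ?mulr_ge0//.
apply: ge0_ler_powR; rewrite ?nnegrE ?invr_ge0 ?(ltW p0) ?mulr_ge0 ?exprn_ge0//.
by rewrite [leRHS]mulrCA ler_wpM2l.
Qed.
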